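(* Let $\{h_k\}_{k\ge1}$ be the Haar system on $[0,1)$ and let $p\ge 3$. Then for every $n\ge 1$ and all real coefficients $a_1,\dots,a_n$, $$\left\|\sum_{k=1}^n a_kh_k\right\|_p\le 2^{1/2}\left(\frac{\Gamma((p+1)/2)}{\sqrt\pi}\right)^{1/p}\left\|\Big(\sum_{k=1}^n a_k^2h_k^2\Big)^{1/2}\right\|_\infty .$$
   Context: Norms are taken in $L^p$ and $L^\infty$ of $[0,1)$ with Lebesgue measure. The Haar functions (normalized in $L^\infty$) are $h_1\equiv 1$ and, for $m=2^k+j$ with $k\ge 0$, $1\le j\le 2^k$, $$h_m(x)=\mathbf 1_{\Delta_m^+}(x)-\mathbf 1_{\Delta_m^-}(x),\quad \Delta_m^+=\left[\frac{j-1}{2^k},\frac{2j-1}{2^{k+1}}\right),\quad \Delta_m^-=\left[\frac{2j-1}{2^{k+1}},\frac{j}{2^k}\right).$$ *)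

(* Defs.v *)
From HB Require Import structures.
From mathcomp Require Import all_boot all_order all_algebra.
From mathcomp Require Import all_classical all_reals all_analysis.

Set Implicit Arguments.
Unset Strict Implicit.
Unset Printing Implicit Defensive.

Import Order.TTheory GRing.Theory Num.Theory.
Import numFieldNormedType.Exports.

Local Open Scope classical_set_scope.
Local Open Scope ring_scope.

(* Lebesgue measure on [0, 1), carried by the whole real line: the norms
   ['N[lebesgue01 R]_p[f]] only see the restriction of f to [0, 1). *)
Definition lebesgue01 (R : realType) :
    {measure set (measurableTypeR R) -> \bar R} :=
  mrestr (@lebesgue_measure R)
    (measurable_itv `[0, 1[ : measurable (`[0, 1[ : set (measurableTypeR R))).

(* Euler's integral; meaningful for s > 0. *)
Definition Gamma (R : realType) (s : R) : R :=
  \int[@lebesgue_measure R]_(t in `]0, +oo[) (t `^ (s - 1) * expR (- t)).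

Definition haar_pos (R : realType) (k j : nat) : set R :=
  `[(j%:R - 1) / 2 ^+ k, (j%:R *+ 2 - 1) / 2 ^+ k.+1[.

Arguments haar_pos R k j : clear implicits.

Definition haar_neg (R : realType) (k j : nat) : set R :=
  `[(j%:R *+ 2 - 1) / 2 ^+ k.+1, j%:R / 2 ^+ k[.

Arguments haar_neg R k j : clear implicits.

(* For m >= 2, the decomposition m = 2 ^ k + j with 1 <= j <= 2 ^ k has
   k = floor (log2 (m - 1)), see [haarE]. Indices start at 1: the value at
   m = 0 is irrelevant. *)
Definition haar (R : realType) (m : nat) (x : R) : R :=
  if (m <= 1)%N then 1 else
  let k := trunc_log 2 m.-1 in
  let j := (m - 2 ^ k)%N in
  \1_(haar_pos R k j) x - \1_(haar_neg R k j) x.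

Lemma haar1 (R : realType) (x : R) : haar 1 x = 1.
Proof. by []. Qed.

Lemma haarE (R : realType) (k j : nat) (x : R) :
  (1 <= j <= 2 ^ k)%N ->
  haar (2 ^ k + j) x = \1_(haar_pos R k j) x - \1_(haar_neg R k j) x.
Proof.
case: j => // j /andP[_ jk]; have k0 : (0 < 2 ^ k)%N by rewrite expn_gt0.
rewrite /haar addnS /= ltnS leqn0 addn_eq0 -leqn0 leqNgt k0 /=.
rewrite (@trunc_log_eq _ k) //; first by rewrite -addnS addKn.
by rewrite leq_addr /= expnS mul2n -addnn ltn_add2l.
Qed.

(* Main.v *)
(* Let [G] be a standard Gaussian, [f_m] and [S_m] the partial sums of [a_k h_k] and
   [a_k^2 h_k^2], and [M] the sup norm of [sqrt S_n]. Then [E |f_m + sqrt (M^2 - S_m) G|^p]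
   is nonincreasing in [m]: it is at most [M^p E |G|^p] at [m = 1] and at least
   [E |f_n|^p] at [m = n]. Given the first [m - 1] terms, the [m]-th one is [d eps] with
   [d] constant and [eps] a fair sign, so monotonicity amounts to
   [E |x + d eps + s G|^p <= E |x + d G' + s G|^p = E |x + sqrt (d^2 + s^2) G|^p].
   The inequality is Jensen's: for [p >= 3] the second derivative of [|x|^p] is convex,
   whence [|x + sqrt t|^p + |x - sqrt t|^p] is convex in [t], and [E G'^2 = 1]. *)

Require Import Defs.
From mathcomp Require Import all_boot all_order all_algebra.
From mathcomp Require Import all_classical all_reals all_analysis.
From mathcomp Require Import measurable_realfun ess_sup_inf.
From mathcomp Require Import ring lra.

Set Implicit Arguments.
Unset Strict Implicit.
Unset Printing Implicit Defensive.

Import Order.TTheory GRing.Theory Num.Theory.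
Import numFieldNormedType.Exports.

Local Open Scope classical_set_scope.
Local Open Scope ring_scope.

(** * Convexity of powers of the absolute value *)

Section abs_powR.
Context {R : realType}.
Implicit Types (p q x y z c d u v : R).

Lemma convex_abs_powR q l u v : 1 <= q -> 0 <= l <= 1 ->
  `|l * u + (1 - l) * v| `^ q <= l * `|u| `^ q + (1 - l) * `|v| `^ q.
Proof.
move=> q1 l01; have q0 : 0 <= q by rewrite (le_trans _ q1).
have /andP[l0 l1] := l01; have k0 : 0 <= 1 - l by rewrite subr_ge0.
apply: (@le_trans _ _ ((l * `|u| + (1 - l) * `|v|) `^ q)).
  apply: ge0_ler_powR => //; rewrite ?nnegrE//.
    by rewrite addr_ge0// mulr_ge0.
  by rewrite (le_trans (ler_normD _ _))// !normrM (ger0_norm l0) (ger0_norm k0).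
have l01' : Itv.spec (@Itv.num_sem R) (Itv.Real `[0, 1]%Z) l.
  by rewrite /= /Itv.num_sem/= in_itv/= l01 ger0_real.
have := @convex_powR R q q1 (@Itv.mk _ _ _ l l01') `|u| `|v|.
rewrite !inE/= !in_itv/= !normr_ge0/= => /(_ isT isT).
by rewrite !convRE.
Qed.

(** Both [x + y] and [x - y] are convex combinations of [x + z] and [x - z], with the weights [l]
    and [1 - l] exchanged, so adding the two convexity inequalities makes the weights sum to 1. *)
Lemma abs_powR_sum_le q x y z : 1 <= q -> 0 <= y <= z ->
  `|x + y| `^ q + `|x - y| `^ q <= `|x + z| `^ q + `|x - z| `^ q.
Proof.
move=> q1 /andP[y0 yz].
have [z0|z0] := leP z 0.
  by have -> : z = y by lra.
pose l := (z + y) / (z *+ 2).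
have l01 : 0 <= l <= 1.
  rewrite /l ler_pdivrMr ?ler_pdivlMr ?mulrn_wgt0//; lra.
have l01' : 0 <= 1 - l <= 1 by lra.
have zl : z * l = (z + y) / 2 by rewrite /l; field; rewrite gt_eqF.
have -> : x + y = l * (x + z) + (1 - l) * (x - z).
  by have := zl; nra.
have -> : x - y = (1 - l) * (x + z) + (1 - (1 - l)) * (x - z).
  by have := zl; nra.
have := convex_abs_powR (x + z) (x - z) q1 l01.
have := convex_abs_powR (x + z) (x - z) q1 l01'.
lra.
Qed.

Lemma cvg_abs_powR0 q : 0 < q -> `|x| `^ q @[x --> (0 : R)] --> (0 : R).
Proof.
move=> q0; apply/cvgrPdist_lt => e e0; near=> x.
rewrite sub0r normrN ger0_norm ?powR_ge0//.
rewrite -[ltRHS]powRr1 ?ltW// -(@mulVf _ q) ?gt_eqF// powRrM.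
rewrite gt0_ltr_powR ?nnegrE ?powR_ge0 ?normr_ge0//.
near: x; apply/nbhs_normP; exists (e `^ q^-1) => /=; first exact: powR_gt0.
by move=> y /=; rewrite sub0r normrN.
Unshelve. all: by end_near. Qed.

Lemma continuous_abs_powR q : 0 < q -> continuous (fun x => `|x| `^ q).
Proof.
move=> q0 x; have [->|x0] := eqVneq x 0.
  by rewrite /continuous_at normr0 powR0 ?gt_eqF//; exact: cvg_abs_powR0.
apply: (continuous_comp (f := fun x : R => `|x|) (g := fun x : R => x `^ q)).
  exact: norm_continuous.
have x0' : 0 < `|x| by rewrite normr_gt0.
apply/differentiable_continuous/derivable1_diffP.
by case: (is_derive1_powR q x0').
Qed.

(** The function is an odd signed power. For [x > 0] it is [u]^ (q + 1)[, for]x < 0[oddness reduces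
    to that case, and at 0 the difference quotient is]|h| [^ q], which tends to 0. *)
Lemma is_derive_id_abs_powR q x : 0 < q ->
  is_derive x 1 (fun u : R => u * `|u| `^ q) ((q + 1) * `|x| `^ q).
Proof.
move=> q0.
have pos y : 0 < y -> is_derive y 1 (fun u : R => u * `|u| `^ q) ((q + 1) * `|y| `^ q).
  move=> y0; have : is_derive y 1 (fun u : R => u `^ (q + 1)) ((q + 1) * `|y| `^ q).
    by rewrite gtr0_norm//; have := @is_derive1_powR _ (q + 1) _ y0; rewrite addrK.
  apply: near_eq_is_derive => //.
  near=> u; have u0 : 0 < u by near: u; exact: lt_nbhsr.
  by rewrite gtr0_norm// powRD ?(gt_eqF u0) ?implybT// powRr1 ?ltW// mulrC.
have [x0|x0|->] := ltgtP x 0; last 2 first.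
- exact: pos.
- rewrite normr0 powR0 ?gt_eqF// mulr0.
  pose f (u : R) : R := u * `|u| `^ q.
  suff fE : (fun h : R => h^-1 *: ((f \o shift 0) (h *: (1 : R)) - f 0)) @ (0 : R)^' --> (0 : R).
    by apply: DeriveDef; [apply/cvg_ex; exists 0; exact: fE|exact/cvg_lim].
  apply: (@cvg_trans _ ((fun h : R => `|h| `^ q) @ (0 : R)^')).
    apply: near_eq_cvg; near=> h.
    have h0 : h != 0 by near: h; exact: nbhs_dnbhs_neq.
    by rewrite /f /= mul0r subr0 addr0 /GRing.scale/= mulr1 mulrA mulVf// mul1r.
  apply: cvg_trans (cvg_abs_powR0 q0); apply: cvg_fmap2; exact: nbhs_dnbhs.
- have : is_derive x 1 ((-%R : R -> R) \o ((fun u : R => u * `|u| `^ q) \o (-%R : R -> R))) ((q + 1) * `|x| `^ q).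
    have xN : 0 < - x by rewrite oppr_gt0.
    have H := pos _ xN.
    apply: is_derive_eq.
    rewrite /GRing.scale/= normrN; ring.
  congr is_derive; apply/funext => u /=; rewrite normrN; ring.
Unshelve. all: by end_near. Qed.

Lemma is_derive_abs_powR q x : 2 < q ->
  is_derive x 1 (fun u : R => `|u| `^ q) (q * (x * `|x| `^ (q - 2))).
Proof.
move=> q2; have q20 : 0 < q - 2 by rewrite subr_gt0.
have -> : (fun u : R => `|u| `^ q) = id * (fun u : R => u * `|u| `^ (q - 2)).
  apply/funext => u /=; rewrite /GRing.mul/= mulrA -expr2 -real_normK ?num_real//.
  rewrite -powR_mulrn// -powRD; first by rewrite addrC subrK.
  by rewrite addrC subrK gt_eqF// (lt_trans _ q2).
apply: (is_derive_eq (is_deriveM (is_derive_id x 1) (is_derive_id_abs_powR x q20))).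
rewrite /GRing.scale/=; ring.
Qed.

Let MVT_le (f df : R -> R) x y : (forall z, is_derive z 1 f (df z)) -> x <= y ->
  exists2 z, x <= z <= y & f y - f x = df z * (y - x).
Proof.
move=> fE xy; apply: (@MVT_segment _ f df) => //.
by apply: derivable_within_continuous => z _; case: (fE z).
Qed.

(* With [g y = |x + y|^p + |x - y|^p], the quotient [g' y / y] is nondecreasing on
   [y > 0] because [g''] is, hence [y |-> g (sqrt y)] is convex; [c] is the slope
   of its tangent at [d ^+ 2]. *)
Lemma abs_powR_sum_tangent p x d : 3 <= p -> 0 <= d ->
  exists2 c : R, 0 <= c & forall y,
    `|x + d| `^ p + `|x - d| `^ p + c * (y ^+ 2 - d ^+ 2)
      <= `|x + y| `^ p + `|x - y| `^ p.
Proof.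
move=> p3 d0.
have p2 : 2 < p by lra.
have p20 : 0 < p - 2 by lra.
pose s (u : R) := u * `|u| `^ (p - 2).
pose g y := `|x + y| `^ p + `|x - y| `^ p.
pose G y := s (x + y) - s (x - y).
pose H y := (p - 1) * (`|x + y| `^ (p - 2) + `|x - y| `^ (p - 2)).
have ds u : is_derive u 1 s ((p - 1) * `|u| `^ (p - 2)).
  by have := is_derive_id_abs_powR u p20; rewrite (_ : p - 2 + 1 = p - 1)//; ring.
have dp (y : R) : is_derive y 1 (fun y : R => x + y) 1.
  by have := is_deriveD (is_derive_cst x y 1) (is_derive_id y (1:R)); rewrite add0r.
have dm (y : R) : is_derive y 1 (fun y : R => x - y) (- 1).
  by have := is_deriveB (is_derive_cst x y 1) (is_derive_id y (1:R)); rewrite sub0r.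
have dG y : is_derive y 1 G (H y).
  have h1 := @is_derive1_comp _ _ (fun y => x + y) _ _ _ (ds (x + y)) (dp y).
  have h2 := @is_derive1_comp _ _ (fun y => x - y) _ _ _ (ds (x - y)) (dm y).
  by apply: (is_derive_eq (is_deriveB h1 h2)); rewrite /H /GRing.scale/=; ring.
have dg y : is_derive y 1 g (p * G y).
  have h1 := @is_derive1_comp _ _ (fun y => x + y) _ _ _ (is_derive_abs_powR (x + y) p2) (dp y).
  have h2 := @is_derive1_comp _ _ (fun y => x - y) _ _ _ (is_derive_abs_powR (x - y) p2) (dm y).
  by apply: (is_derive_eq (is_deriveD h1 h2)); rewrite /G /s /GRing.scale/=; ring.
have G0 : G 0 = 0 by rewrite /G addr0 subr0 subrr.
have H0 y : 0 <= H y.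
  by apply: mulr_ge0; [lra|rewrite addr_ge0 ?powR_ge0].
(* The hypothesis [3 <= p] enters here: the exponent [p - 2] in [H] is at least 1, so
   [abs_powR_sum_le] applies. *)
have Hle y z : 0 <= y -> y <= z -> H y <= H z.
  move=> y0 yz; apply: ler_wpM2l; first lra.
  by apply: abs_powR_sum_le; [lra|rewrite y0].
have G_ge0 y : 0 <= y -> 0 <= G y.
  move=> y0; have [z _] := MVT_le dG y0.
  by rewrite G0 !subr0 => ->; rewrite mulr_ge0.
(* This says that [G y / y] is nondecreasing, cleared of denominators. As [G 0 = 0], the mean slope
   [H u] of [G] on [[0, y]] is at most its mean slope [H v] on [[y, z]]. *)
have Gratio y z : 0 <= y -> y <= z -> z * G y <= y * G z.
  move=> y0 yz.
  have [u /andP[u0 uy]] := MVT_le dG y0; rewrite G0 !subr0 => Gy.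
  have [v /andP[yv vz] Gzy] := MVT_le dG yz.
  have Huv : H u <= H v by apply: Hle => //; exact: le_trans yv.
  have : 0 <= (z - y) * y * (H v - H u) by rewrite !mulr_ge0 ?subr_ge0.
  have : G z = H v * (z - y) + H u * y by rewrite -Gzy -Gy; ring.
  by move=> -> ; rewrite Gy; nra.
(* Since [g' = p * G], this is [g' d / (2 d)], the derivative of [g (sqrt t)] at [t = d ^+ 2]. When
   [d = 0] the inverse defaults to 0, so [c = 0] and it remains to see that [g] is nondecreasing on
   [y >= 0]. *)
pose c := p * G d / d / 2.
have c0 : 0 <= c by rewrite !mulr_ge0 ?invr_ge0 ?G_ge0//; lra.
exists c => // y.
wlog y0 : y / 0 <= y => [hwlog|].
  have [|yN] := leP 0 y; first exact: hwlog.
  have := hwlog (- y); rewrite oppr_ge0 sqrrN opprK.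
  by move/(_ (ltW yN)); rewrite [leRHS]addrC.
pose k y := g y - c * (y * y).
have dk z : is_derive z 1 k (p * G z - c * (2 * z)).
  have h := is_deriveZ c (is_deriveM (is_derive_id z (1 : R)) (is_derive_id z (1 : R))).
  by apply: (is_derive_eq (is_deriveB (dg z) h)); rewrite /GRing.scale/=; ring.
suff : k d <= k y by rewrite /k /g -!expr2; lra.
have [d00|dpos] := eqVneq d 0.
  have dy : d <= y by rewrite d00.
  have [z /andP[dz zy]] := MVT_le dk dy.
  have -> : c = 0 by rewrite /c d00 invr0 mulr0 mul0r.
  rewrite mul0r subr0 -subr_ge0 => ->.
  rewrite mulr_ge0 ?subr_ge0// mulr_ge0 ?G_ge0//; last exact: le_trans d0 dz.
  by apply: ltW; lra.
have {dpos} d1 : 0 < d by rewrite lt_def dpos.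
(* Up to positive factors the derivative of [k] at [z > 0] is [G z / z - G d / d], nonpositive
   before [d] and nonnegative after it. Hence [k] attains its minimum over [y >= 0] at [d]. *)
have dkE z : d * (p * G z - c * (2 * z)) = p * (d * G z - z * G d).
  by rewrite /c; field; rewrite gt_eqF.
have [dy|/ltW yd] := leP d y.
  have [z /andP[dz zy] kE] := MVT_le dk dy.
  rewrite -subr_ge0 -(pmulr_rge0 _ d1) kE [d * _]mulrA dkE.
  apply: mulr_ge0; rewrite ?subr_ge0// mulr_ge0 ?subr_ge0 ?Gratio//.
  by apply: ltW; lra.
have [z /andP[yz zd] kE] := MVT_le dk yd.
rewrite -subr_le0 -(pmulr_rle0 _ d1) kE [d * _]mulrA dkE.
apply: mulr_le0_ge0; rewrite ?subr_ge0// mulr_ge0_le0 ?subr_le0 ?Gratio//.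
  by apply: ltW; lra.
exact: le_trans yz.
Qed.

End abs_powR.

(** * Gaussian moments *)

Section gaussian.
Context {R : realType}.
Local Notation mu := (@lebesgue_measure R).
Local Notation gamma := (@normal_pdf R 0 1).
Implicit Types (p x y z c d r s m : R) (f g : R -> R).

Let intD f g : measurable_fun setT f -> measurable_fun setT g ->
  (forall x, 0 <= f x) -> (forall x, 0 <= g x) ->
  (\int[mu]_x (f x + g x)%:E = \int[mu]_x (f x)%:E + \int[mu]_x (g x)%:E)%E.
Proof.
move=> mf mg f0 g0; under eq_integral do rewrite EFinD.
by rewrite ge0_integralD// => [x _||x _|]; rewrite ?lee_fin//; exact/measurable_EFinP.
Qed.

Let intZ c f : measurable_fun setT f -> (forall x, 0 <= f x) -> 0 <= c ->
  (\int[mu]_x (c * f x)%:E = c%:E * \int[mu]_x (f x)%:E)%E.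
Proof.
move=> mf f0 c0; under eq_integral do rewrite EFinM.
by rewrite ge0_integralZl//; [exact/measurable_EFinP|move=> x _; rewrite lee_fin].
Qed.

Let int_le f g : measurable_fun setT f -> measurable_fun setT g ->
  (forall x, 0 <= f x <= g x) ->
  (\int[mu]_x (f x)%:E <= \int[mu]_x (g x)%:E)%E.
Proof.
move=> mf mg fg; apply: ge0_le_integral => //; try exact/measurable_EFinP.
- by move=> x _; rewrite lee_fin; have /andP[] := fg x.
- by move=> x _; rewrite lee_fin; have /andP[] := fg x.
Qed.

Lemma normal_pdf_standard m s y : 0 < s ->
  normal_pdf m s y = s^-1 * gamma ((y - m) / s).
Proof.
move=> s0; rewrite !normal_pdfE ?oner_neq0 ?gt_eqF// [RHS]mulrA; congr (_ * _).
  rewrite /normal_peak -mulrnAr sqrtrM ?sqr_ge0// sqrtr_sqr gtr0_norm//.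
  by rewrite expr1n mul1r invfM.
rewrite /normal_fun subr0 expr1n; congr expR.
by rewrite -(mulr_natr (s ^+ 2)); field; rewrite gt_eqF.
Qed.

Lemma standard_normal_pdfE y : gamma y = normal_peak 1 * expR (- (y ^+ 2 / 2)).
Proof.
by rewrite normal_pdfE ?oner_neq0// /normal_fun subr0 expr1n mulNr.
Qed.

(** For [0 < s < 1], [s] times the density of variance [s ^+ 2] equals
    [gamma y * expR (- t * y ^+ 2)] with [t = (s ^- 2 - 1) / 2]. Bounding the exponential below by
    [1 - t * y ^+ 2] and integrating gives [1 <= s + t * M], that is [M >= 2 s ^+ 2 / (1 + s)],
    which tends to 1 with [s]. *)
Lemma normal_second_moment_ge1 : (1 <= \int[mu]_y (y ^+ 2 * gamma y)%:E)%E.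
Proof.
set M := (X in (_ <= X)%E).
have g0 y : 0 <= gamma y by exact: normal_pdf_ge0.
have mg : measurable_fun setT gamma by exact: measurable_normal_pdf.
have M0 : (0 <= M)%E by apply: integral_ge0 => y _; rewrite lee_fin mulr_ge0 ?sqr_ge0.
have key s : 0 < s < 1 -> (1 <= s%:E + ((s ^- 2 - 1) / 2)%:E * M)%E.
  move=> /andP[s0 s1].
  have t0 : 0 <= (s ^- 2 - 1) / 2.
    by rewrite divr_ge0// subr_ge0 invf_ge1 ?exprn_gt0// expr_le1// ltW.
  rewrite -[leLHS](@integral_normal_pdf R 0 1).
  rewrite -[s%:E]mule1 -[X in (s%:E * X)%E](@integral_normal_pdf R 0 s).
  have mp : measurable_fun setT (@normal_pdf R 0 s) by exact: measurable_normal_pdf.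
  have p0 y : 0 <= normal_pdf 0 s y by exact: normal_pdf_ge0.
  have my : measurable_fun setT (fun y => y ^+ 2 * gamma y).
    by apply: measurable_funM => //; exact: measurable_funX.
  have y0 y : 0 <= y ^+ 2 * gamma y by rewrite mulr_ge0 ?sqr_ge0.
  rewrite -!intZ ?(ltW s0)// -intD; last 4 first.
  - exact: measurable_funM.
  - exact: measurable_funM.
  - by move=> y; rewrite mulr_ge0// ltW.
  - by move=> y; rewrite mulr_ge0.
  apply: int_le => //.
    by apply: measurable_funD; exact: measurable_funM.
  move=> y; rewrite g0/= (normal_pdf_standard 0 y s0) subr0.
  rewrite mulVKf ?gt_eqF// !standard_normal_pdfE.
  have -> : - ((y / s) ^+ 2 / 2) = - (y ^+ 2 / 2) - (s ^- 2 - 1) / 2 * y ^+ 2.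
    by field; rewrite gt_eqF.
  rewrite expRD; set e := expR (- _); set w := _ / 2 * _.
  have e0 : 0 <= normal_peak 1 * e by rewrite mulr_ge0 ?normal_peak_ge0 ?expR_ge0.
  have := expR_ge1Dx (- w).
  move=> /(ler_wpM2l e0); rewrite /w; lra.
rewrite leNgt; apply/negP => M1.
have Mfin : M \is a fin_num by rewrite ge0_fin_numE// (lt_trans M1) ?ltry.
move: M0 M1 key; rewrite -(fineK Mfin); move: (fine M) => N.
(* If [N < 1], the midpoint [s] of [N] and 1 gives a contradiction:
   [2 s ^+ 2 / (1 + s) > 2 s - 1 = N]. *)
rewrite lee_fin lte_fin => N0 N1 /(_ ((1 + N) / 2)).
have -> : 0 < (1 + N) / 2 < 1 by lra.
move=> /(_ isT); rewrite -EFinM -EFinD lee_fin; set s := (1 + N) / 2.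
have s0 : 0 < s by rewrite /s; lra.
move/(ler_wpM2l (sqr_ge0 s)).
have -> : s ^+ 2 * (s + (s ^- 2 - 1) / 2 * N) = s ^+ 3 + (1 - s ^+ 2) / 2 * N.
  by field; rewrite gt_eqF.
have sN : N = 2 * s - 1 by rewrite /s; field.
rewrite sN in N0 N1 *; nra.
Qed.

Lemma ge0_integral_oppr f : measurable_fun setT f -> (forall x, 0 <= f x) ->
  (\int[mu]_x (f (- x))%:E = \int[mu]_x (f x)%:E)%E.
Proof.
move=> mf f0.
have mN : measurable_fun setT (-%R : measurableTypeR R -> measurableTypeR R) by [].
rewrite [LHS](_ : _ = \int[pushforward mu (-%R : _ -> measurableTypeR R)]_x (f x)%:E)%E.
  apply: eq_measure_integral => //= A mA _; exact: lebesgue_measureN.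
rewrite ge0_integral_pushforward//; first exact/measurable_EFinP.
by move=> x _; rewrite lee_fin.
Qed.

Lemma ge0_integral_affine a c f : 0 < a -> continuous f -> (forall x, 0 <= f x) ->
  (\int[mu]_x (f x)%:E = \int[mu]_x (f (a * x + c) * a)%:E)%E.
Proof.
move=> a0 cf f0.
have dF x : is_derive x 1 (fun x => a * x + c) a.
  by have := is_deriveD (is_deriveZ a (is_derive_id x (1:R))) (is_derive_cst c x 1);
    rewrite addr0 /GRing.scale/= mulr1.
have F'E : derive1 (fun x => a * x + c) = cst a.
  by apply/funext => x; rewrite derive1E; exact: derive_val.
rewrite (@increasing_ge0_integration_by_substitutionT _ (fun x => a * x + c) f)//.
- by apply: eq_integral => x _ /=; rewrite /GRing.mul/= F'E.
- by move=> x y xy; rewrite ltrD2r ltr_pM2l.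
- by rewrite F'E => ?; exact: cvg_cst.
- by rewrite F'E; exact: is_cvg_cst.
- by rewrite F'E; exact: is_cvg_cst.
- exact: (cvg_comp _ (+%R^~ c) (gt0_cvgMrNy a0 (@cvg_id _ _))) (cvg_addrr_Ny c).
- exact: (cvg_comp _ (+%R^~ c) (gt0_cvgMry a0 (@cvg_id _ _))) (cvg_addrr c).
Qed.

Let mgamma : measurable_fun setT gamma. Proof. exact: measurable_normal_pdf. Qed.
Let gamma0 y : 0 <= gamma y. Proof. exact: normal_pdf_ge0. Qed.

(** The tangent inequality at [y = d * z] is integrated against [gamma]. The linear term contributes
    [c * d ^+ 2 * (E G^2 - 1)], which is nonnegative, and by symmetry of [G] the two integrals on
    the right coincide. *)
Lemma gaussian_two_point p x d : 3 <= p -> 0 <= d ->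
  ((`|x + d| `^ p + `|x - d| `^ p)%:E <=
    2%:E * \int[mu]_z (`|x + d * z| `^ p * gamma z)%:E)%E.
Proof.
move=> p3 d0; have [c c0 xdc] := abs_powR_sum_tangent x p3 d0.
have p0 : 0 <= p by lra.
set A := _ + _ in xdc *.
have m1 (e : R) : measurable_fun setT (fun z => `|x + e * z| `^ p * gamma z).
  apply: measurable_funM => //; apply: (@measurableT_comp _ _ _ _ _ _ (fun x : R => x `^ p)) => //.
  apply: measurableT_comp => //; apply: measurable_funD => //; exact: measurable_funM.
have p1 (e z : R) : 0 <= `|x + e * z| `^ p * gamma z by rewrite mulr_ge0 ?powR_ge0.
have m2 : measurable_fun setT (fun y => y ^+ 2 * gamma y).
  by apply: measurable_funM => //; exact: measurable_funX.
have p2 y : 0 <= y ^+ 2 * gamma y by rewrite mulr_ge0 ?sqr_ge0.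
have A0 : 0 <= A by rewrite addr_ge0 ?powR_ge0.
have cd0 : 0 <= c * d ^+ 2 by rewrite mulr_ge0 ?sqr_ge0.
have mZ e f : measurable_fun setT f -> measurable_fun setT (fun z => e * f z).
  by move=> mf; exact: measurable_funM.
have nZ e f : 0 <= e -> (forall z, 0 <= f z) -> forall z, 0 <= e * f z.
  by move=> e0 f0 z; exact: mulr_ge0.
pose I (e : R) : \bar R := (\int[mu]_z (`|x + e * z| `^ p * gamma z)%:E)%E.
(* The term [c * d ^+ 2] is moved to the right, so that every integrand is nonnegative; being
   finite, it is cancelled at the end. *)
have h : (A%:E + (c * d ^+ 2)%:E * \int[mu]_z (z ^+ 2 * gamma z)%:E <=
    (I d + I (- d)%R) + (c * d ^+ 2)%:E)%E.
  rewrite -[A%:E]mule1 -[X in (_ <= _ + X)%E]mule1 -(@integral_normal_pdf R 0 1).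
  rewrite -!intZ// -!intD//; try solve [exact: mZ|exact: nZ|exact: measurable_funD|by move=> z; rewrite addr_ge0].
  apply: int_le.
  - by apply: measurable_funD; exact: mZ.
  - by apply: measurable_funD; [exact: measurable_funD|exact: mZ].
  move=> z; apply/andP; split.
    by apply: addr_ge0; exact: mulr_ge0.
  have := ler_wpM2r (gamma0 z) (xdc (d * z)); rewrite exprMn mulNr; lra.
have IN : I (- d) = I d.
  rewrite /I -(ge0_integral_oppr (m1 d) (p1 d)); apply: eq_integral => u _.
  by rewrite mulNr mulrN /normal_pdf !oner_eq0 /= /normal_fun !subr0 sqrrN.
move: h; rewrite IN -mule2n -mule_natl => h.
have cdfin : (c * d ^+ 2)%:E \is a fin_num by [].
rewrite -(leeD2rE _ _ cdfin); apply: le_trans h; apply: leeD2l.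
by apply: lee_pemulr; [rewrite lee_fin|exact: normal_second_moment_ge1].
Qed.

(** If [U], [V] are independent standard Gaussians, so is [a U + b V]. After the substitution
    [w = a u + b v], the joint density of [(v, w)] is symmetric in its arguments; Tonelli then
    integrates [v] out first, over a probability density. *)
Lemma gaussian_convolution a b f : 0 < a -> a ^+ 2 + b ^+ 2 = 1 ->
  continuous f -> (forall x, 0 <= f x) ->
  (\int[mu]_v ((gamma v)%:E * \int[mu]_u (f (a * u + b * v) * gamma u)%:E) =
   \int[mu]_w (f w * gamma w)%:E)%E.
Proof.
move=> a0 ab cf f0.
have mf : measurable_fun setT f by exact: continuous_measurable_fun.
pose k v w := gamma v * (f w * normal_pdf (b * v) a w).
have kE v w : k v w = f w * gamma w * normal_pdf (b * w) a v.
  rewrite /k !(normal_pdf_standard _ _ a0) !standard_normal_pdfE.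
  (* Because [a ^+ 2 + b ^+ 2 = 1], both exponents equal [- (v ^+ 2 - 2 b v w + w ^+ 2) / (2 a ^+
     2)]. *)
  set c := normal_peak 1.
  have : expR (- (v ^+ 2 / 2)) * expR (- (((w - b * v) / a) ^+ 2 / 2)) =
         expR (- (w ^+ 2 / 2)) * expR (- (((v - b * w) / a) ^+ 2 / 2)).
    rewrite -!expRD; congr expR.
    have a2 : a ^+ 2 != 0 by rewrite gt_eqF// exprn_gt0.
    have b2 : b ^+ 2 = 1 - a ^+ 2 by rewrite -ab; ring.
    rewrite !exprMn !exprVn; apply: (mulfI a2).
    have -> : (w - b * v) ^+ 2 = w ^+ 2 - 2 * b * v * w + b ^+ 2 * v ^+ 2 by ring.
    have -> : (v - b * w) ^+ 2 = v ^+ 2 - 2 * b * v * w + b ^+ 2 * w ^+ 2 by ring.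
    by rewrite b2; field; rewrite gt_eqF.
  set e1 := expR _; set e2 := expR _; set e3 := expR _; set e4 := expR _ => h.
  transitivity (c * c * a^-1 * f w * (e1 * e2)); first by ring.
  by rewrite h; ring.
have k0 v w : 0 <= k v w by rewrite !mulr_ge0 ?normal_pdf_ge0.
have inner v : ((gamma v)%:E * \int[mu]_u (f (a * u + b * v) * gamma u)%:E =
    \int[mu]_w (k v w)%:E)%E.
  rewrite [RHS]intZ; last 3 first.
  - by apply: measurable_funM => //; exact: measurable_normal_pdf.
  - by move=> w; rewrite mulr_ge0 ?normal_pdf_ge0.
  - exact: gamma0.
  congr (_ * _)%E; rewrite (@ge0_integral_affine a (b * v)); last 3 first.
  - exact: a0.
  - move=> x; apply: cvgM; first exact: cf.
    by apply: continuous_normal_pdf; rewrite gt_eqF.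
  - by move=> w; rewrite mulr_ge0 ?normal_pdf_ge0.
  apply: eq_integral => u _; congr EFin.
  rewrite (normal_pdf_standard _ _ a0) addrK.
  have -> : a * u / a = u by field; rewrite gt_eqF.
  by field; rewrite gt_eqF.
under eq_integral do rewrite inner.
have mk : measurable_fun setT (fun z : measurableTypeR R * measurableTypeR R => (k z.1 z.2)%:E).
  apply/measurable_EFinP; rewrite /k.
  under eq_fun do rewrite (normal_pdf_standard _ _ a0).
  apply: measurable_funM; first exact: measurableT_comp.
  apply: measurable_funM; first exact: measurableT_comp.
  apply: measurable_funM => //; apply: (@measurableT_comp _ _ _ _ _ _ gamma) => //.
  apply: measurable_funM => //; apply: measurable_funB => //.
  exact: measurable_funM.
rewrite (@fubini_tonelli _ _ _ _ _ mu mu _ mk) => [|z]; last by rewrite lee_fin.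
apply: eq_integral => w _ /=.
under eq_integral do rewrite kE.
rewrite intZ ?integral_normal_pdf ?mule1//.
- exact: measurable_normal_pdf.
- by move=> v; exact: normal_pdf_ge0.
- by rewrite mulr_ge0.
Qed.

(** This is [E |x + s G|^p], kept extended-valued so that moments can be compared without
    integrability arguments. *)
Definition gaussian_moment p x s : \bar R :=
  (\int[mu]_z (`|x + s * z| `^ p * gamma z)%:E)%E.

Lemma gaussian_moment_ge0 p x s : (0 <= gaussian_moment p x s)%E.
Proof. by apply: integral_ge0 => z _; rewrite lee_fin mulr_ge0 ?powR_ge0. Qed.

Let continuous_affine_powR p x s : 2 < p -> continuous (fun z => `|x + s * z| `^ p).
Proof.
move=> p2 z; apply: (continuous_comp (f := fun z => x + s * z) (g := fun y => `|y| `^ p)).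
  by apply: cvgD; [exact: cvg_cst|apply: cvgM; [exact: cvg_cst|exact: cvg_id]].
by apply: continuous_abs_powR; rewrite (lt_trans _ p2).
Qed.

Let measurable_affine_powR p x s : measurable_fun setT (fun z => `|x + s * z| `^ p * gamma z).
Proof.
apply: measurable_funM => //; apply: (@measurableT_comp _ _ _ _ _ _ (fun x : R => x `^ p)) => //.
by apply: measurableT_comp => //; apply: measurable_funD => //; exact: measurable_funM.
Qed.

Let affine_powR_ge0 p x s z : 0 <= `|x + s * z| `^ p * gamma z.
Proof. by rewrite mulr_ge0 ?powR_ge0. Qed.

Lemma measurable_gaussian_moment p disp (T : measurableType disp) (f g : T -> R) :
  measurable_fun setT f -> measurable_fun setT g ->
  measurable_fun setT (fun t => gaussian_moment p (f t) (g t)).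
Proof.
move=> mf mg.
pose h (z : T * measurableTypeR R) := (`|f z.1 + g z.1 * z.2| `^ p * gamma z.2)%:E.
apply: (@measurable_fun_fubini_tonelli_F _ _ _ _ _ mu h).
  apply/measurable_EFinP; apply: measurable_funM; last exact: measurableT_comp.
  apply: (@measurableT_comp _ _ _ _ _ _ (fun x : R => x `^ p)) => //.
  apply: measurableT_comp => //; apply: measurable_funD; first exact: measurableT_comp.
  by apply: measurable_funM => //; exact: measurableT_comp.
by move=> z; rewrite lee_fin mulr_ge0 ?powR_ge0.
Qed.

(** Conditionally on the Gaussian [v] attached to [s], [gaussian_two_point] centred at [x + s * v]
    replaces the sign in front of [d] by a Gaussian. The two independent Gaussians then merge into
    one of standard deviation [r], by [gaussian_convolution] with weights [d / r] and [s / r]. *)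
Lemma gaussian_moment_step p x d s r : 3 <= p -> 0 <= r -> r ^+ 2 = d ^+ 2 + s ^+ 2 ->
  (gaussian_moment p (x + d) s + gaussian_moment p (x - d) s
    <= 2%:E * gaussian_moment p x r)%E.
Proof.
move=> p3 r0 rds.
wlog d0 : d rds / 0 <= d => [hwlog|].
  have [|dN] := leP 0 d; first exact: hwlog.
  have := hwlog (- d); rewrite sqrrN opprK oppr_ge0 => /(_ rds (ltW dN)) h.
  rewrite addeC; exact: h.
have p2 : 2 < p by lra.
(* The convolution needs a positive first weight. If [d = 0], then [s] is [r] or [- r], and the
   symmetry of the Gaussian settles both. *)
have [d00|dn0] := eqVneq d 0.
  rewrite d00 addr0 subr0 -mule2n -mule_natl; apply: lee_wpmul2l; first by rewrite lee_fin.
  move: rds; rewrite d00 expr0n add0r => /eqP; rewrite eqf_sqr => /orP[/eqP->//|/eqP ->].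
  rewrite /gaussian_moment -(ge0_integral_oppr (measurable_affine_powR p x s)) => [|z]; last exact: affine_powR_ge0.
  rewrite le_eqVlt; apply/orP; left; apply/eqP; apply: eq_integral => z _.
  by rewrite mulNr mulrN /normal_pdf !oner_eq0 /= /normal_fun !subr0 sqrrN.
have {dn0} {}d0 : 0 < d by rewrite lt_def dn0.
have rpos : 0 < r.
  rewrite lt_def r0 andbT; apply/eqP => rE; move: rds; rewrite rE expr0n /=; nra.
have ab : (d / r) ^+ 2 + (s / r) ^+ 2 = 1.
  by rewrite !exprMn -mulrDl -rds exprVn divff// gt_eqF// exprn_gt0.
have -> : gaussian_moment p x r = (\int[mu]_v ((gamma v)%:E * gaussian_moment p (x + s * v) d))%E.
  have E u v : x + r * (d / r * u + s / r * v) = x + s * v + d * u.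
    by field; rewrite gt_eqF.
  rewrite /gaussian_moment -(gaussian_convolution (divr_gt0 d0 rpos) ab (continuous_affine_powR (x := x) (s := r) p2)); last by move=> w; rewrite powR_ge0.
  apply: eq_integral => v _; under eq_integral do rewrite E.
  by [].
have mv : measurable_fun setT (fun v => (gamma v)%:E * gaussian_moment p (x + s * v) d)%E.
  apply: emeasurable_funM; first exact/measurable_EFinP.
  apply: measurable_gaussian_moment => //.
  by apply: measurable_funD => //; exact: measurable_funM.
rewrite [X in (X + _)%E]/gaussian_moment [X in (_ + X)%E]/gaussian_moment -intD//.
rewrite -ge0_integralZl//; last first.
- by move=> v _; apply: mule_ge0; [rewrite lee_fin|exact: gaussian_moment_ge0].
apply: ge0_le_integral => //.
- by move=> v _; rewrite lee_fin addr_ge0.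
- apply/measurable_EFinP; apply: measurable_funD; exact: measurable_affine_powR.
- exact: measurable_funeM.
move=> v _; rewrite muleCA -mulrDl mulrC EFinM; apply: lee_wpmul2l; first by rewrite lee_fin.
have := gaussian_two_point (x + s * v) p3 (ltW d0).
by rewrite (_ : x + s * v + d = x + d + s * v)//; [rewrite (_ : x + s * v - d = x - d + s * v)//; ring|ring].
Qed.

(** By convexity [2 |x|^p] is at most [|x + s|^p + |x - s|^p], and [gaussian_two_point] bounds the
    latter. This discards the variance left over after the last Haar term. *)
Lemma gaussian_moment_ge p x s : 3 <= p -> 0 <= s ->
  ((`|x| `^ p)%:E <= gaussian_moment p x s)%E.
Proof.
move=> p3 s0; have p1 : 1 <= p by lra.
have h : (2%:E * (`|x| `^ p)%:E <= 2%:E * gaussian_moment p x s)%E.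
  apply: le_trans (gaussian_two_point x p3 s0).
  rewrite -EFinM lee_fin; have := @abs_powR_sum_le _ p x 0 s p1.
  by rewrite lexx s0 addr0 subr0 => /(_ isT); lra.
by move: h; rewrite lee_pmul2l.
Qed.

Lemma gaussian_momentN p x s : gaussian_moment p (- x) s = gaussian_moment p x s.
Proof.
rewrite /gaussian_moment.
rewrite -(ge0_integral_oppr (@measurable_affine_powR p x s) (@affine_powR_ge0 p x s)).
apply: eq_integral => z _.
rewrite -normrN opprD opprK mulrN.
by rewrite /normal_pdf !oner_eq0 /= /normal_fun !subr0 sqrrN.
Qed.

Lemma gaussian_moment_scale p s : 0 <= s ->
  gaussian_moment p 0 s = ((s `^ p)%:E * gaussian_moment p 0 1)%E.
Proof.
move=> s0; rewrite /gaussian_moment -intZ; [|exact: measurable_affine_powR|exact: affine_powR_ge0|exact: powR_ge0].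
apply: eq_integral => z _.
by rewrite !add0r mul1r normrM powRM// (ger0_norm s0) mulrA.
Qed.

End gaussian.

(** * Euler's integral *)

Section gamma_function.
Context {R : realType}.
Local Notation mu := (@lebesgue_measure R).
Implicit Types (s t p : R).

(** [Gamma] is a real-valued integral, which defaults to 0 when the extended one is infinite, so
    finiteness has to be shown. The integrand is dominated by a multiple of the exponential density
    of rate 1/2. *)
Lemma Gamma_integral s : 1 < s ->
  (Gamma s)%:E = (\int[mu]_(t in `]0%R, +oo[) (t `^ (s - 1) * expR (- t))%:E)%E.
Proof.
move=> s1; have r0 : 0 < s - 1 by rewrite subr_gt0.
rewrite /Gamma /Rintegral fineK//.
have mT : measurable_fun setT (fun t : R => t `^ (s - 1) * expR (- t)).
  by apply: measurable_funM => //; exact: measurableT_comp.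
rewrite ge0_fin_numE; last first.
  by apply: integral_ge0 => t _; rewrite lee_fin mulr_ge0 ?powR_ge0 ?expR_ge0.
(* The factor 2 cancels the rate 1/2 in front of the exponential density. *)
pose C := 2 * ((s - 1) *+ 2) `^ (s - 1).
have C0 : 0 <= C by rewrite mulr_ge0 ?powR_ge0.
have half : 0 <= 2^-1 :> R by [].
apply: (@le_lt_trans _ _ (\int[mu]_(t in `]0%R, +oo[) (C * exponential_pdf 2^-1 t)%:E)%E).
  apply: ge0_le_integral => //.
  - by move=> t _; rewrite lee_fin mulr_ge0 ?powR_ge0 ?expR_ge0.
  - by apply/measurable_EFinP/measurable_funTS.
  - apply/measurable_EFinP/measurable_funTS; apply: measurable_funM => //.
    exact: measurable_exponential_pdf.
  move=> t /=; rewrite in_itv/= andbT => t0.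
  rewrite lee_fin exponential_pdfE ?(ltW t0)//.
  (* [x <= expR x] at [x = t / (2 (s - 1))], raised to the power [s - 1]. *)
  have tr : t `^ (s - 1) <= ((s - 1) *+ 2) `^ (s - 1) * expR (t / 2).
    have -> : expR (t / 2) = expR (t / ((s - 1) *+ 2)) `^ (s - 1).
      by rewrite -expRM; congr expR; field; rewrite gt_eqF.
    rewrite -powRM ?expR_ge0 ?mulrn_wge0 ?(ltW r0)//.
    apply: ge0_ler_powR; rewrite ?nnegrE ?(ltW r0) ?(ltW t0)//.
      by rewrite mulr_ge0 ?expR_ge0 ?mulrn_wge0 ?(ltW r0).
    have r2 : 0 < (s - 1) *+ 2 by rewrite mulrn_wgt0.
    rewrite mulrC -ler_pdivrMr//; apply: le_trans (expR_ge1Dx _); lra.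
  apply: le_trans (ler_wpM2r (expR_ge0 _) tr) _.
  rewrite -mulrA -expRD /C; rewrite (_ : t / 2 - t = - 2^-1 * t); last by field.
  by rewrite le_eqVlt; apply/orP; left; apply/eqP; field.
apply: (@le_lt_trans _ _ (\int[mu]_t (C * exponential_pdf 2^-1 t)%:E)%E).
  apply: ge0_subset_integral => //.
    apply/measurable_EFinP; apply: measurable_funM => //; exact: measurable_exponential_pdf.
  by move=> t _; rewrite lee_fin mulr_ge0// exponential_pdf_ge0.
under eq_integral do rewrite EFinM.
rewrite ge0_integralZl//; last 2 first.
- by apply/measurable_EFinP; exact: measurable_exponential_pdf.
- by move=> t _; rewrite lee_fin exponential_pdf_ge0.
by rewrite integral_exponential_pdf// mule1 ltry.
Qed.

(** By evenness the moment is twice the integral over [z >= 0], where [t = z ^+ 2 / 2], [dt = z dz]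
    turns [|z|^p gamma z dz] into [K t^r expR (- t) dt] with [r = (p - 1) / 2]. *)
Lemma gaussian_moment_le_Gamma p : 3 <= p ->
  (gaussian_moment p 0 1 <= (2 `^ (p / 2) * (Gamma ((p + 1) / 2) / Num.sqrt pi))%:E)%E.
Proof.
move=> p3; have p0 : 0 < p by lra.
set r := (p - 1) / 2; have r0 : 0 < r by rewrite /r; lra.
have rE : (p + 1) / 2 - 1 = r by rewrite /r; field.
pose K : R := 2 `^ r * normal_peak 1.
have K0 : 0 <= K by rewrite mulr_ge0 ?powR_ge0 ?normal_peak_ge0.
pose G (t : R) := K * (`|t| `^ r * expR (- t)).
pose f (z : R) := `|z| `^ p * normal_pdf 0 1 z.
have f0 z : 0 <= f z by rewrite mulr_ge0 ?powR_ge0 ?normal_pdf_ge0.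
have cf : continuous f.
  by move=> z; apply: cvgM; [exact: continuous_abs_powR|apply: continuous_normal_pdf; exact: oner_neq0].
have mf : measurable_fun setT f by exact: continuous_measurable_fun.
have G0 t : 0 <= G t by rewrite mulr_ge0// mulr_ge0 ?powR_ge0 ?expR_ge0.
have cG : continuous G.
  move=> t; apply: cvgM; first exact: cvg_cst.
  apply: cvgM; first exact: continuous_abs_powR.
  by apply: (continuous_comp (f := -%R) (g := expR)); [exact: continuousN|exact: continuous_expR].
have mG : measurable_fun setT (EFin \o G).
  by apply/measurable_EFinP; exact: continuous_measurable_fun.
pose F (z : R) : R := 2^-1 * (z * z).
have dF (z : R) : is_derive z 1 F z.
  have h := is_deriveZ 2^-1 (is_deriveM (is_derive_id z (1 : R)) (is_derive_id z (1 : R))).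
  by apply: (is_derive_eq h); rewrite /GRing.scale/=; field.
have F'E : derive1 F = id.
  by apply/funext => z; rewrite derive1E; exact: derive_val.
have cF : continuous F.
  by move=> z; apply/differentiable_continuous/derivable1_diffP; case: (dF z).
have F0 : F 0 = 0 by rewrite /F !mulr0.
have fE (z : R) : 0 <= z -> ((G \o F) * derive1 F) z = f z.
  move=> z0; rewrite F'E /GRing.mul/= /f standard_normal_pdfE /G.
  have -> : z ^+ 2 / 2 = F z by rewrite /F; field.
  have Fz0 : 0 <= F z by rewrite !mulr_ge0.
  rewrite !ger0_norm// /K.
  have -> : F z `^ r = (2 `^ r)^-1 * (z `^ r * z `^ r).
    by rewrite /F !powRM ?mulr_ge0// -[2^-1]powR_inv1// -powRrM mulN1r powRN.
  have -> : z `^ p = z `^ r * z `^ r * z.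
    rewrite -[X in _ * X]powRr1// -!powRD; first by congr powR; rewrite /r; field.
      by apply/implyP => /eqP; rewrite /r; lra.
    by apply/implyP => /eqP; rewrite /r; lra.
  by field; rewrite gt_eqF// powR_gt0.
(* The substitution is made on compact intervals; the half-line integral is the supremum of
   these. *)
have bound n : (\int[mu]_(z in `[0%R, n.+1%:R%R]) (f z)%:E <=
    \int[mu]_(t in `]0%R, +oo[) (G t)%:E)%E.
  rewrite integral_itv_obnd_cbnd; last exact: measurable_funTS.
  rewrite [leLHS](_ : _ = \int[mu]_(t in `[F 0%R, F n.+1%:R%R]) (G t)%:E)%E.
    rewrite F0; apply: ge0_subset_integral => //.
    - exact: measurable_funTS.
    - by move=> t _; rewrite lee_fin.
    - exact: subset_itvl.
  rewrite (@integration_by_substitution_increasing _ F G 0 n.+1%:R)//.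
  - apply: eq_integral => z; rewrite inE/= in_itv/= => /andP[z0 _].
    by congr EFin; rewrite fE.
  - move=> x y; rewrite !in_itv/= => /andP[x0 _] /andP[y0 _] xy.
    by rewrite /F -!expr2 ltr_pM2l// ltr_pXn2r.
  - by move=> x _; rewrite F'E; exact: cvg_id.
  - by rewrite F'E; apply/cvg_ex; exists 0; apply: cvg_at_right_filter; exact: cvg_id.
  - by rewrite F'E; apply/cvg_ex; exists n.+1%:R; apply: cvg_at_left_filter; exact: cvg_id.
  - split.
    + by move=> z _; case: (dF z).
    + by apply: cvg_at_right_filter; exact: cF.
    + by apply: cvg_at_left_filter; exact: cF.
  - exact: continuous_subspaceT.
have -> : gaussian_moment p 0 1 = (\int[mu]_z (f z)%:E)%E.
  by apply: eq_integral => z _; rewrite add0r mul1r.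
rewrite ge0_symfun_integralT//; last first.
  by move=> z; rewrite /f/= normrN /normal_pdf !oner_eq0 /= /normal_fun !subr0 sqrrN.
rewrite (_ : [set x | 0 <= x] = `[0, +oo[%classic); last first.
  by apply/seteqP; split => x /=; rewrite in_itv/= andbT.
rewrite ge0_integral_ereal_sup//.
apply: (@le_trans _ _ (2%:E * \int[mu]_(t in `]0%R, +oo[) (G t)%:E)%E).
  by rewrite lee_pmul2l//; apply: ge_ereal_sup => _ [n _ <-]; exact: bound.
have -> : (\int[mu]_(t in `]0%R, +oo[) (G t)%:E = K%:E * (Gamma ((p + 1) / 2))%:E)%E.
  rewrite Gamma_integral; last lra.
  rewrite -ge0_integralZl; last 4 first.
  - exact: measurable_itv.
  - apply/measurable_EFinP/measurable_funTS; apply: measurable_funM => //.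
    exact: measurableT_comp.
  - by move=> t _; rewrite lee_fin mulr_ge0 ?powR_ge0 ?expR_ge0.
  - by rewrite lee_fin.
  apply: eq_integral => t; rewrite inE/= in_itv/= andbT => t0.
  by rewrite rE -EFinM /G gtr0_norm.
rewrite -!EFinM lee_fin le_eqVlt; apply/orP; left; apply/eqP.
have -> : 2 `^ (p / 2) = 2 `^ r * Num.sqrt 2 :> R.
  rewrite -powR12_sqrt// -powRD; first by congr powR; rewrite /r; field.
  by apply/implyP => _; exact: lt0r_neq0.
have s2 : Num.sqrt 2 != 0 :> R by rewrite gt_eqF// sqrtr_gt0.
have spi : Num.sqrt pi != 0 :> R by rewrite gt_eqF// sqrtr_gt0 pi_gt0.
rewrite /K /normal_peak expr1n mul1r -(mulr_natr pi) sqrtrM ?pi_ge0//.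
have h : 2 = Num.sqrt 2 * Num.sqrt 2 :> R by rewrite -expr2 sqr_sqrtr.
move: h s2 spi; set q := Num.sqrt 2; set w := 2 `^ r; set u := Num.sqrt pi => h q0 u0.
rewrite [X in X * _ = _]h; field.
by rewrite q0 u0.
Qed.

End gamma_function.

(** * Dyadic intervals and Haar functions *)

Section haar_structure.
Context {R : realType}.
Implicit Types (x y : R) (k l c i j m : nat).

(** Positions count from 0, so the halves of [dyadic k j] are [dyadic k.+1 j.*2] and
    [dyadic k.+1 j.*2.+1]. *)
Definition dyadic l c : set R := `[c%:R / 2 ^+ l, c.+1%:R / 2 ^+ l[.

Lemma haar_posE k j : haar_pos R k j.+1 = dyadic k.+1 j.*2.
Proof.
have k0 : (2 : R) ^+ k != 0 by rewrite expf_neq0.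
have E1 : (j.+1%:R - 1) / 2 ^+ k = j.*2%:R / 2 ^+ k.+1 :> R.
  by rewrite -natr1 addrK -muln2 natrM exprS; field.
have E2 : j.+1%:R *+ 2 - 1 = j.*2.+1%:R :> R.
  by rewrite -!natr1 -muln2 natrM; ring.
by rewrite /haar_pos /dyadic E1 E2.
Qed.

Lemma haar_negE k j : haar_neg R k j.+1 = dyadic k.+1 j.*2.+1.
Proof.
have k0 : (2 : R) ^+ k != 0 by rewrite expf_neq0.
have E1 : j.+1%:R / 2 ^+ k = j.*2.+2%:R / 2 ^+ k.+1 :> R.
  by rewrite -doubleS -muln2 natrM exprS; field.
have E2 : j.+1%:R *+ 2 - 1 = j.*2.+1%:R :> R.
  by rewrite -!natr1 -muln2 natrM; ring.
by rewrite /haar_neg /dyadic E1 E2.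
Qed.

Lemma dyadic_rat k l c : (l <= k)%N ->
  c%:R / 2 ^+ l = (c * 2 ^ (k - l))%:R / 2 ^+ k :> R.
Proof.
move=> lk; rewrite natrM natrX.
have -> : 2 ^+ k = 2 ^+ l * 2 ^+ (k - l) :> R by rewrite -exprD subnKC.
by field; rewrite !expf_neq0.
Qed.

(** Nestedness of dyadic intervals, read on indices: over the common denominator [2 ^+ k], a shared
    point forces strict inequalities between integer numerators. *)
Lemma dyadic_index k l c i x : (l <= k)%N -> dyadic l c x -> dyadic k i x ->
  (c * 2 ^ (k - l) <= i < c.+1 * 2 ^ (k - l))%N.
Proof.
move=> lk; rewrite /dyadic /= !in_itv/= => /andP[cx xc] /andP[ix xi].
have e0 : 0 < 2 ^+ k :> R by rewrite exprn_gt0.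
have E (c' : nat) := dyadic_rat c' lk.
rewrite -ltnS; apply/andP; split; rewrite -(@ltr_nat R) -(@ltr_pM2r _ (2 ^+ k)^-1) ?invr_gt0//.
  by rewrite -E (le_lt_trans cx).
by rewrite -E (le_lt_trans ix).
Qed.

Lemma dyadic_sub k l c i x y : (l <= k)%N -> dyadic k i x -> dyadic k i y ->
  dyadic l c x -> dyadic l c y.
Proof.
move=> lk ix iy cx; have /andP[ci ic] := dyadic_index lk cx ix.
have E (c' : nat) := dyadic_rat c' lk.
move: iy; rewrite /dyadic /= !in_itv/= !E => /andP[iy yi]; apply/andP; split.
  by rewrite (le_trans _ iy)// ler_pM2r ?invr_gt0 ?exprn_gt0// ler_nat.
by rewrite (lt_le_trans yi)// ler_pM2r ?invr_gt0 ?exprn_gt0// ler_nat.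
Qed.

Lemma dyadic_half k c x : dyadic k.+1 c x -> dyadic k c./2 x.
Proof.
have E (n : nat) : n%:R / 2 ^+ k = n.*2%:R / 2 ^+ k.+1 :> R.
  by rewrite exprS -muln2 natrM; field; rewrite expf_neq0.
have e0 : 0 < (2 ^+ k.+1)^-1 :> R by rewrite invr_gt0 exprn_gt0.
rewrite /dyadic /= !in_itv/= !E => /andP[cx xc]; apply/andP; split.
  by apply: le_trans cx; rewrite ler_pM2r// ler_nat -[leqRHS]odd_double_half leq_addl.
by apply: lt_le_trans xc _; rewrite ler_pM2r// ler_nat -ltn_half_double.
Qed.

Lemma measurable_dyadic l c : measurable (dyadic l c : set (measurableTypeR R)).
Proof. exact: measurable_itv. Qed.

Lemma lebesgue01_dyadic l c : (c < 2 ^ l)%N ->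
  lebesgue01 R (dyadic l c) = (2 ^- l)%:E.
Proof.
move=> cl; have e0 : 0 < 2 ^+ l :> R by rewrite exprn_gt0.
rewrite /lebesgue01 /= /mrestr setIidl; last first.
  move=> x; rewrite /dyadic /= !in_itv/= => /andP[cx xc]; apply/andP; split.
    by apply: le_trans cx; rewrite divr_ge0// ltW.
  by rewrite (lt_le_trans xc)// ler_pdivrMr// mul1r -natrX ler_nat.
rewrite lebesgue_measure_itv/= lte_fin ltr_pM2r ?invr_gt0// ltr_nat leqnn.
by rewrite -EFinB -mulrBl -natrB// subSnn mul1r.
Qed.

Lemma haar_indexP m : (2 <= m)%N -> exists k j, (j < 2 ^ k)%N /\ m = (2 ^ k + j.+1)%N.
Proof.
case: m => // -[//|m] _; have /andP[km mk] := @trunc_log_bounds 2 m.+1 isT isT.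
exists (trunc_log 2 m.+1), (m.+1 - 2 ^ trunc_log 2 m.+1)%N; split.
  by rewrite ltn_subLR// addnn -mul2n -expnS.
by rewrite addnS subnKC.
Qed.

Lemma haar_dyadic k j x : (j < 2 ^ k)%N ->
  haar (2 ^ k + j.+1) x = \1_(dyadic k.+1 j.*2) x - \1_(dyadic k.+1 j.*2.+1) x.
Proof. by move=> jk; rewrite haarE ?haar_posE ?haar_negE. Qed.

Lemma measurable_haar m : measurable_fun setT (haar m : measurableTypeR R -> R).
Proof.
have [m1|m1] := leqP m 1.
  by rewrite (_ : haar m = cst 1)//; apply/funext => x; rewrite /haar m1.
have [k [j [jk ->]]] := haar_indexP m1.
rewrite (funext (fun x => haar_dyadic x jk)).
by apply: measurable_funB; exact: measurable_indic (measurable_dyadic _ _).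
Qed.

Lemma haar_sqr_le1 m x : haar m x ^+ 2 <= 1.
Proof.
rewrite /haar; case: ifP => [_|_]; first by rewrite expr1n.
rewrite !indicE; case: (_ \in _); case: (_ \in _); rewrite /=; nra.
Qed.

Lemma dyadic_disj k j x : dyadic k j x -> dyadic k j.+1 x -> False.
Proof.
move=> jx j1x; have := dyadic_index (leqnn k) jx j1x.
by rewrite subnn expn0 !muln1 ltnn andbF.
Qed.

(** An earlier function of a coarser level [l < k] jumps only at endpoints of level at most [k], so
    each of its halves contains or misses [dyadic k j]. One of the same level lives on a different
    interval and vanishes here. *)
Lemma haar_earlier_cst k j i x y : (j < 2 ^ k)%N -> (i < 2 ^ k + j.+1)%N ->
  dyadic k j x -> dyadic k j y -> haar i x = haar i y.
Proof.
move=> jk ik jx jy; have [i1|i1] := leqP i 1; first by rewrite /haar i1.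
have [l [c [cl iE]]] := haar_indexP i1; rewrite iE !haar_dyadic//.
have lk : (l <= k)%N.
  rewrite leqNgt; apply/negP => kl; have : (2 ^ k + j.+1 <= 2 ^ l)%N.
    rewrite (leq_trans _ (leq_pexp2l _ kl))// expnS mul2n -addnn leq_add2l//.
  by move=> /(leq_trans ik); rewrite iE ltnNge leq_addr.
have [lk'|kl] := ltnP l k.
  have E d : \1_(dyadic l.+1 d) x = \1_(dyadic l.+1 d) y :> R.
    rewrite !indicE; congr (nat_of_bool _)%:R; apply/idP/idP; rewrite !inE.
      exact: (dyadic_sub lk' jx jy).
    exact: (dyadic_sub lk' jy jx).
  by rewrite !E.
have lE : l = k by apply/eqP; rewrite eqn_leq lk kl.
have cj : (c < j)%N by move: ik; rewrite iE lE ltn_add2l ltnS.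
have off z d : dyadic k j z -> d./2 = c -> \1_(dyadic k.+1 d) z = 0 :> R.
  move=> jz dc; rewrite indicE memNset// => /dyadic_half; rewrite dc => cz.
  have := dyadic_index (leqnn k) cz jz.
  by rewrite subnn expn0 !muln1 => /andP[_]; rewrite ltnS leqNgt cj.
have cU : c.*2.+1./2 = c by rewrite /= uphalf_double.
by rewrite lE (off x _ jx (doubleK c)) (off x _ jx cU) (off y _ jy (doubleK c)) (off y _ jy cU).
Qed.

(** The martingale structure, freed of the indices [k] and [j]: on [A] and [B] the [m]-th function
    is a fair sign while all earlier ones are frozen. Positive measure allows a point of [A] to be
    chosen outside a null set. *)
Lemma haar_support m : (2 <= m)%N ->
  exists A B : set (measurableTypeR R),
  [/\ measurable A, measurable B, A `&` B = set0,
      lebesgue01 R A = lebesgue01 R B & (0 < lebesgue01 R A)%E] /\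
  [/\ forall x, A x -> haar m x = 1, forall x, B x -> haar m x = -1,
      forall x, ~ (A `|` B) x -> haar m x = 0 &
      forall i x y, (i < m)%N -> (A `|` B) x -> (A `|` B) y -> haar i x = haar i y].
Proof.
move=> m2; have [k [j [jk ->]]] := haar_indexP m2.
have j2 : (j.*2.+1 < 2 ^ k.+1)%N by rewrite expnS mul2n ltn_Sdouble.
exists (dyadic k.+1 j.*2), (dyadic k.+1 j.*2.+1); split; split.
- exact: measurable_dyadic.
- exact: measurable_dyadic.
- by apply/seteqP; split => // x [] /dyadic_disj; apply.
- by rewrite !lebesgue01_dyadic// (ltn_trans _ j2).
- by rewrite lebesgue01_dyadic ?(ltn_trans _ j2)// lte_fin invr_gt0 exprn_gt0.
- move=> x Ax; rewrite haar_dyadic// !indicE mem_set// memNset ?subr0//.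
  exact: dyadic_disj Ax.
- move=> x Bx; rewrite haar_dyadic// !indicE memNset ?mem_set ?sub0r// => Ax.
  exact: dyadic_disj Ax Bx.
- move=> x /not_orP[nA nB]; rewrite haar_dyadic// !indicE !memNset ?subr0//.
have sub z : (dyadic k.+1 j.*2 `|` dyadic k.+1 j.*2.+1) z -> dyadic k j z.
  by case=> /dyadic_half; rewrite /= ?doubleK ?uphalf_double.
by move=> i x y im /sub jx /sub jy; exact: haar_earlier_cst jx jy.
Qed.

End haar_structure.

(** * The Haar martingale *)

Section balanced_split.
Local Open Scope ereal_scope.

(** Conditional expectation in elementary form: on [A] and [B], of equal mass, the mean
    [(v + w) / 2] of [g] is at most the constant value [u] of [f], and elsewhere the two functions
    agree. *)
Lemma balanced_split_integral_le d (T : measurableType d) (R : realType)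
    (mu : {measure set T -> \bar R}) (A B : set T) (f g : T -> \bar R) (u v w : \bar R) :
  measurable A -> measurable B -> A `&` B = set0 -> mu A = mu B ->
  measurable_fun setT f -> measurable_fun setT g ->
  (forall x, 0 <= f x) -> (forall x, 0 <= g x) ->
  0 <= u -> 0 <= v -> 0 <= w ->
  (forall x, (A `|` B) x -> f x = u) ->
  (forall x, A x -> g x = v) -> (forall x, B x -> g x = w) ->
  (forall x, ~ (A `|` B) x -> g x = f x) ->
  v + w <= 2%:E * u ->
  \int[mu]_x g x <= \int[mu]_x f x.
Proof.
move=> mA mB AB muAB mf mg f0 g0 u0 v0 w0 fE gA gB gf vw.
have mAB : measurable (A `|` B) by exact: measurableU.
have split (h : T -> \bar R) : measurable_fun setT h -> (forall x, 0 <= h x) ->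
    \int[mu]_x h x = \int[mu]_(x in A) h x + \int[mu]_(x in B) h x + \int[mu]_(x in ~` (A `|` B)) h x.
  move=> mh h0; rewrite -{1}(setUv (A `|` B)) ge0_integral_setU//; last 3 first.
  - exact: measurableC.
  - by rewrite setUv.
  - exact/disj_setPCl.
  rewrite ge0_integral_setU//; first exact: measurable_funTS.
  by rewrite disj_set2E AB eqxx.
rewrite !split//.
rewrite (eq_integral (fun=> v)); last by move=> x /set_mem; exact: gA.
rewrite [X in _ + X + _](eq_integral (fun=> w)); last by move=> x /set_mem; exact: gB.
rewrite [X in _ <= X + _ + _](eq_integral (fun=> u)); last by move=> x /set_mem Ax; apply: fE; left.
rewrite [X in _ <= _ + X + _](eq_integral (fun=> u)); last by move=> x /set_mem Bx; apply: fE; right.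
rewrite [X in _ + X <= _](eq_integral f); last by move=> x /set_mem; exact: gf.
apply: leeD2r; rewrite !integral_cst// -muAB -!ge0_muleDl//.
by apply: lee_wpmul2r => //; rewrite -mule2n -mule_natl.
Qed.

End balanced_split.

Section haar_gaussian.
Context {R : realType}.
Variables (p : R) (a : nat -> R).
Hypothesis p3 : 3 <= p.
Local Notation mu := (lebesgue01 R).
Implicit Types (x y M : R) (m n : nat).

Let f m x : R := \sum_(1 <= k < m.+1) a k * haar k x.
Let S m x : R := \sum_(1 <= k < m.+1) a k ^+ 2 * haar k x ^+ 2.

Let fS m x : f m.+1 x = f m x + a m.+1 * haar m.+1 x.
Proof. by rewrite /f big_nat_recr. Qed.

Let SS m x : S m.+1 x = S m x + a m.+1 ^+ 2 * haar m.+1 x ^+ 2.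
Proof. by rewrite /S big_nat_recr. Qed.

Let S_le m n x : (m <= n)%N -> S m x <= S n x.
Proof.
move=> mn; rewrite -(subnK mn); elim: (n - m)%N => // i; rewrite addSn SS.
by move=> /le_trans; apply; rewrite lerDl mulr_ge0 ?sqr_ge0.
Qed.

Let mf m : measurable_fun setT (f m : measurableTypeR R -> R).
Proof.
elim: m => [|m IH].
  by rewrite (_ : f 0 = cst 0)//; apply/funext => x; rewrite /f big_geq.
rewrite (funext (fS m)); apply: measurable_funD => //.
by apply: measurable_funM => //; exact: measurable_haar.
Qed.

Let mS m : measurable_fun setT (S m : measurableTypeR R -> R).
Proof.
elim: m => [|m IH].
  by rewrite (_ : S 0 = cst 0)//; apply/funext => x; rewrite /S big_geq.
rewrite (funext (SS m)); apply: measurable_funD => //.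
by apply: measurable_funM => //; apply: measurable_funX; exact: measurable_haar.
Qed.

(* The variance [M ^+ 2 - S m] not yet used by the partial sum is carried by an
   independent Gaussian. *)
Let W M m x := gaussian_moment p (f m x) (Num.sqrt (M ^+ 2 - S m x)).

Let mW M m : measurable_fun setT (W M m : measurableTypeR R -> \bar R).
Proof.
apply: measurable_gaussian_moment; first exact: mf.
apply: (@measurableT_comp _ _ _ _ _ _ (@Num.sqrt R)); first by apply: continuous_measurable_fun; exact: sqrt_continuous.
by apply: measurable_funB.
Qed.

Lemma ae_exists (A : set (measurableTypeR R)) (P : R -> Prop) :
  measurable A -> (0 < mu A)%E -> (\forall x \ae mu, P x) -> exists2 x, A x & P x.
Proof.
move=> mA A0 [N [mN N0 PN]]; apply: contrapT => noA.
have : (mu A <= mu N)%E.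
  apply: le_measure; rewrite ?inE// => x Ax; apply: PN => /= Px; apply: noA; by exists x.
by rewrite N0 leNgt A0.
Qed.

Lemma integral_step M m n : (1 <= m < n)%N -> (\forall x \ae mu, S n x <= M ^+ 2) ->
  (\int[mu]_x W M m.+1 x <= \int[mu]_x W M m x)%E.
Proof.
move=> /andP[m1 mn] SM.
have [A [B [[mA mB AB muAB A0] [hA hB hAB cst_h]]]] := @haar_support R m.+1 m1.
have [x0 Ax0 Sx0] := ae_exists mA A0 SM.
have f_cst x : (A `|` B) x -> f m x = f m x0.
  move=> xAB; apply: eq_big_nat => k /andP[_ km].
  by rewrite (cst_h k x x0)//; left.
have S_cst x : (A `|` B) x -> S m x = S m x0.
  move=> xAB; apply: eq_big_nat => k /andP[_ km].
  by rewrite (cst_h k x x0)//; left.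
(* [Num.sqrt] of a negative number is 0, so the variance must be known to suffice on all of [A] and
   [B]. Both [S m] and the square of the new term are constant there, so the single good point [x0]
   is enough. *)
have room : S m x0 + a m.+1 ^+ 2 <= M ^+ 2.
  by apply: le_trans Sx0; apply: le_trans (S_le _ mn); rewrite SS hA// expr1n mulr1.
pose b := Num.sqrt (M ^+ 2 - (S m x0 + a m.+1 ^+ 2)).
apply: (balanced_split_integral_le (u := W M m x0)
  (v := gaussian_moment p (f m x0 + a m.+1) b)
  (w := gaussian_moment p (f m x0 - a m.+1) b) mA mB AB muAB).
- exact: mW.
- exact: mW.
- by move=> x; exact: gaussian_moment_ge0.
- by move=> x; exact: gaussian_moment_ge0.
- exact: gaussian_moment_ge0.
- exact: gaussian_moment_ge0.
- exact: gaussian_moment_ge0.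
- by move=> x xAB; rewrite /W (f_cst _ xAB) (S_cst _ xAB).
- move=> x Ax; have xAB : (A `|` B) x by left.
  by rewrite /W fS SS (hA _ Ax) (f_cst _ xAB) (S_cst _ xAB) expr1n !mulr1.
- move=> x Bx; have xAB : (A `|` B) x by right.
  by rewrite /W fS SS (hB _ Bx) (f_cst _ xAB) (S_cst _ xAB) sqrrN expr1n mulrN !mulr1.
- by move=> x xAB; rewrite /W fS SS (hAB _ xAB) expr0n !mulr0 !addr0.
(* The variance [M ^+ 2 - S m] splits into the square of the coefficient [a m.+1] and the remainder
   [b ^+ 2]. *)
apply: gaussian_moment_step; [exact: p3|exact: sqrtr_ge0|]; rewrite !sqr_sqrtr ?subr_ge0//; first ring.
by apply: le_trans room; rewrite lerDl sqr_ge0.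
Qed.

Lemma integral_abs_powR_le M n : (1 <= n)%N -> 0 <= M ->
  (\forall x \ae mu, S n x <= M ^+ 2) ->
  (\int[mu]_x (`|f n x| `^ p)%:E <= gaussian_moment p 0 M)%E.
Proof.
move=> n1 M0 SM.
have muT : mu setT = 1%:E.
  by rewrite /lebesgue01 /= /mrestr setTI lebesgue_measure_itv/= lte01 oppr0 adde0.
apply: (@le_trans _ _ (\int[mu]_x W M n x)%E).
  apply: ge0_le_integral => //.
  - apply/measurable_EFinP; apply: (@measurableT_comp _ _ _ _ _ _ (fun x : R => x `^ p)) => //.
    by apply: measurableT_comp => //; exact: mf.
  - by move=> x _; apply: gaussian_moment_ge; rewrite ?sqrtr_ge0.
have W1 : forall m, (m < n)%N -> (\int[mu]_x W M m.+1 x <= \int[mu]_x W M 1 x)%E.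
  elim=> [_|m IH mn]; first exact: lexx.
  apply: (le_trans _ (IH (ltnW mn))).
  by apply: integral_step SM; rewrite ltn0Sn.
rewrite -(prednK n1); apply: le_trans (W1 n.-1 _) _; first by rewrite prednK.
have [x0 _ Sx0] := @ae_exists setT (fun x => S n x <= M ^+ 2) measurableT (ltac:(by rewrite muT lte_fin)) SM.
have aM : a 1 ^+ 2 <= M ^+ 2.
  apply: le_trans Sx0; apply: le_trans (S_le _ n1).
  by rewrite /S big_nat1 haar1 expr1n mulr1.
have WE x : W M 1 x = gaussian_moment p (a 1%N) (Num.sqrt (M ^+ 2 - a 1%N ^+ 2)).
  by rewrite /W /f /S !big_nat1 haar1 expr1n !mulr1.
under eq_integral do rewrite WE.
rewrite integral_cst; last exact: measurableT.
rewrite muT mule1.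
(* The first Haar function is the constant 1, not a sign. Applying the step at centre 0 creates one:
   the moments centred at [a 1] and [- a 1] are equal, so their sum is twice the one wanted. *)
have aM' : M ^+ 2 = a 1%N ^+ 2 + Num.sqrt (M ^+ 2 - a 1%N ^+ 2) ^+ 2.
  by rewrite sqr_sqrtr ?subr_ge0//; ring.
have := gaussian_moment_step 0 p3 M0 aM'.
rewrite add0r sub0r gaussian_momentN -mule2n -mule_natl lee_pmul2l//.
Qed.

End haar_gaussian.

(** * Passage from moments to norms *)

Theorem corollary1p2 (R : realType) (p : R) (hp : 3 <= p)
    (n : nat) (hn : (1 <= n)%N) (a : nat -> R) :
  ('N[lebesgue01 R]_(p%:E) [EFin \o
        (fun x : R => \sum_(1 <= k < n.+1) a k * haar k x)%R]
   <= (Num.sqrt 2 * (Gamma ((p + 1) / 2) / Num.sqrt pi) `^ (1 / p))%:E *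
      'N[lebesgue01 R]_(+oo) [EFin \o
        (fun x : R =>
           Num.sqrt (\sum_(1 <= k < n.+1) a k ^+ 2 * haar k x ^+ 2))%R])%E.
Proof.
set f := (fun x : R => \sum_(1 <= k < n.+1) a k * haar k x).
pose S x := \sum_(1 <= k < n.+1) a k ^+ 2 * haar k x ^+ 2.
set N := ('N[_]_(+oo) [_])%E.
have p0 : 0 < p by lra.
have S0 x : 0 <= S x by apply: sumr_ge0 => k _; rewrite mulr_ge0 ?sqr_ge0.
have NE : N = ess_sup (lebesgue01 R) (fun x : R => `|(Num.sqrt (S x))%:E|%E).
  by rewrite /N unlock ifT//= /mrestr setTI lebesgue_measure_itv/= lte01 oppr0 adde0 lte01.
have N0 : (0 <= N)%E by exact: Lnorm_ge0.
(* Haar functions are bounded by 1 in absolute value, so [S] is at most the sum of the [a k ^+ 2].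
   Finiteness makes [fine N] a legitimate choice for [M]. *)
have Nfin : N \is a fin_num.
  rewrite ge0_fin_numE// NE.
  apply: (@le_lt_trans _ _ (Num.sqrt (\sum_(1 <= k < n.+1) a k ^+ 2))%:E); last exact: ltry.
  apply/ess_supP; apply: nearW => x; rewrite /= ger0_norm ?sqrtr_ge0// lee_fin.
  apply: ler_wsqrtr; apply: ler_sum => k _.
  by rewrite ler_piMr ?sqr_ge0 ?haar_sqr_le1.
have M0 : 0 <= fine N by exact: fine_ge0.
have SM : \forall x \ae lebesgue01 R, S x <= fine N ^+ 2.
  have := ess_sup_ge (lebesgue01 R) (fun x : R => `|(Num.sqrt (S x))%:E|%E).
  apply: filterS => x; rewrite -NE /= ger0_norm ?sqrtr_ge0// -(fineK Nfin) lee_fin => h.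
  by rewrite -(sqr_sqrtr (S0 x)) ler_pXn2r// nnegrE ?sqrtr_ge0.
have fp := integral_abs_powR_le (a := a) hp hn M0 SM.
have Gp := gaussian_moment_le_Gamma hp.
set Q := Gamma _ / _ in Gp *.
(* [Q] is nonnegative because a positive multiple of it dominates a Gaussian moment; this licenses
   distributing the root over the product. *)
have Q0 : 0 <= Q.
  rewrite -(pmulr_rge0 _ (powR_gt0 (p / 2) (ltr0n R 2 : 0 < 2))) -lee_fin.
  by apply: le_trans Gp; exact: gaussian_moment_ge0.
rewrite unlock; under eq_integral do rewrite /=.
apply: (@le_trans _ _ ((fine N `^ p * (2 `^ (p / 2) * Q))%:E `^ p^-1)%E).
  apply: gt0_ler_poweR; rewrite ?invr_ge0 ?(ltW p0)//.
  - by rewrite in_itv/= leey andbT integral_ge0// => x _; rewrite lee_fin powR_ge0.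
  - by rewrite in_itv/= leey andbT lee_fin; apply: mulr_ge0; [|apply: mulr_ge0 => //]; exact: powR_ge0.
  apply: (le_trans fp); rewrite gaussian_moment_scale// EFinM.
  by apply: lee_wpmul2l => //; rewrite lee_fin powR_ge0.
rewrite poweR_EFin -(fineK Nfin) -EFinM lee_fin /=.
rewrite (powRM _ (powR_ge0 _ _) (mulr_ge0 (powR_ge0 _ _) Q0)) (powRM _ (powR_ge0 _ _) Q0).
have pE : p / 2 * p^-1 = 2^-1 by field; rewrite gt_eqF.
rewrite -!powRrM divff ?gt_eqF// powRr1// pE powR12_sqrt// div1r.
by rewrite mulrC.
Qed.
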